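(* Let $K$ be a field of characteristic different from $2$ and let $X$ be a connected poset such that every multiplicative automorphism of $FI(X,K)$ is inner and every derivation from $FI(X,K)$ to $I(X,K)$ is inner. Let $\lambda$ be an involution on $X$ with more than one fixed point in $X$, and let $X_3=\{x\in X:\lambda(x)=x\}$. Let $\epsilon_1,\epsilon_2:X_3\to K^*$ be maps such that the involutions $\rho_{\epsilon_1}$ and $\rho_{\epsilon_2}$ on $FI(X,K)$ are not equivalent via inner automorphism. Then $\rho_{\epsilon_1}$ and $\rho_{\epsilon_2}$ are equivalent if and only if there exists an automorphism $\alpha:X\to X$ such that $\alpha\circ\lambda=\lambda\circ\alpha$, and $\rho_{\epsilon_2\circ\alpha}$ and $\rho_{\epsilon_1}$ are equivalent via inner automorphism.
   Context: For a field $K$ and a poset $X$, the incidence space $I(X,K)$ is the $K$-space of functions $f:X\times X\to K$ with $f(x,y)=0$ whenever $x\nleq y$. The finitary incidence algebra $FI(X,K)$ is the subspace of all $f\in I(X,K)$ such that for all $x\le y$ in $X$ there are only finitely many subintervals $[u,v]\subseteq[x,y]$ with $u\ne v$ and $f(u,v)\neq 0$. It is an associative unital $K$-algebra under convolution $(fg)(x,y)=\sum_{x\le z\le y}f(x,z)g(z,y)$, and the same formula makes $I(X,K)$ an $FI(X,K)$-bimodule. Inner automorphisms of an algebra are the maps $a\mapsto uau^{-1}$, $u$ a unit. An involution on a $K$-algebra is a $K$-linear anti-automorphism whose square is the identity; an involution on a poset $X$ is a bijection $\lambda$ with $x\le y\Leftrightarrow\lambda(y)\le\lambda(x)$ and $\lambda^2=\mathrm{id}$.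 An automorphism of a poset is a bijection $\alpha$ with $x\le y\Leftrightarrow\alpha(x)\le\alpha(y)$. Involutions $\phi,\varphi$ on a $K$-algebra $A$ are equivalent if $\Psi\circ\phi=\varphi\circ\Psi$ for some $K$-linear automorphism $\Psi$ of $A$, and equivalent via inner automorphism if $\Psi$ can be chosen inner. A poset is connected if any two elements are joined by a finite sequence in which consecutive elements are comparable. A multiplicative automorphism of $FI(X,K)$ is a map $M_\sigma(f)(x,y)=\sigma(x,y)f(x,y)$, where $\sigma\in I(X,K)$ satisfies $\sigma(x,y)\neq0$ for all $x\le y$ and $\sigma(x,y)\sigma(y,z)=\sigma(x,z)$ for $x\le y\le z$. A derivation $D:FI(X,K)\to I(X,K)$ is a $K$-linear map with $D(fg)=D(f)g+fD(g)$; it is inner if there is $i\in I(X,K)$ with $D(f)=fi-if$ for all $f$. Set $\rho_\lambda(f)(x,y)=f(\lambda(y),\lambda(x))$ for $f\in FI(X,K)$. For a map $\epsilon:X_3\to K^*$, let $u_\epsilon\in FI(X,K)$ be the diagonal function with $u_\epsilon(x,x)=\epsilon(x)$ for $x\in X_3$ and $u_\epsilon(x,x)=1$ for $x\notin X_3$; then $\rho_\epsilon(f)=u_\epsilon\rho_\lambda(f)u_\epsilon^{-1}$ is an involution on $FI(X,K)$. If $\alpha$ is an automorphism of $X$ commuting with $\lambda$, then $\alpha(X_3)\subseteq X_3$, so $\epsilon\circ\alpha:X_3\to K^*$ is well defined. *)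

(* Defs.v *)
From HB Require Import structures.
From mathcomp Require Import all_boot all_order all_algebra.
From mathcomp Require Import all_classical.

Set Implicit Arguments.
Unset Strict Implicit.
Unset Printing Implicit Defensive.

Import Order.TTheory GRing.Theory.
Local Open Scope classical_set_scope.
Local Open Scope ring_scope.

Section Posets.
Variables (d : Order.disp_t) (X : porderType d).

Definition connected_poset : Prop :=
  forall x y : X, exists s : seq X,
    path (fun a b => a >=< b)%O x s /\ last x s = y.

Record poset_involution := PosetInvolution {
  poset_inv_fun :> X -> X;
  poset_inv_le : forall x y,
    (x <= y)%O = (poset_inv_fun y <= poset_inv_fun x)%O;
  poset_invK : involutive poset_inv_fun
}.

Record poset_aut := PosetAut {
  poset_aut_fun :> X -> X;
  poset_aut_le : forall x y,
    (x <= y)%O = (poset_aut_fun x <= poset_aut_fun y)%O;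
  poset_aut_bij : bijective poset_aut_fun
}.

Definition fixpts (lam : X -> X) := {x : X | lam x == x}.

Lemma fixpts_aut_subproof (lam alpha : X -> X) :
  alpha \o lam =1 lam \o alpha ->
  forall z : fixpts lam, lam (alpha (val z)) == alpha (val z).
Proof.
by move=> comm [x /= /eqP fx]; rewrite -[lam _]/((lam \o alpha) x) -comm /= fx.
Qed.

Definition fixpts_aut (lam alpha : X -> X)
    (comm : alpha \o lam =1 lam \o alpha) (z : fixpts lam) : fixpts lam :=
  exist _ (alpha (val z)) (fixpts_aut_subproof comm z).

End Posets.

Section IncidenceSpace.
Variables (K : fieldType) (d : Order.disp_t) (X : porderType d).

Definition incidence_pred : {pred X -> X -> K} :=
  fun f => `[< forall x y, ~~ (x <= y)%O -> f x y = 0 >].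

Lemma incidence_zmod_closed : zmod_closed incidence_pred.
Proof.
split; first by apply/asboolP.
move=> f g /asboolP hf /asboolP hg; apply/asboolP => x y nxy.
by rewrite !fctE hf // hg // subrr.
Qed.

HB.instance Definition _ :=
  GRing.isZmodClosed.Build (X -> X -> K) incidence_pred incidence_zmod_closed.

Record incidence := Incidence {
  incidence_fun :> X -> X -> K;
  incidenceP : incidence_fun \in incidence_pred
}.

HB.instance Definition _ := [isSub for incidence_fun].
HB.instance Definition _ := [Choice of incidence by <:].
HB.instance Definition _ := [SubChoice_isSubZmodule of incidence by <:].

Lemma incidence_eq0 (f : incidence) x y : ~~ (x <= y)%O -> f x y = 0.
Proof. by case: f => f /= /asboolP; apply. Qed.

Lemma incidence_le (f : incidence) x y : f x y != 0 -> (x <= y)%O.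
Proof. by apply: contraR => /incidence_eq0 ->. Qed.

Lemma incidence_ext (f g : incidence) : (forall x y, f x y = g x y) -> f = g.
Proof. by move=> fg; apply/val_inj/funext => x; apply/funext => y. Qed.

Lemma incidence0E x y : (0 : incidence) x y = 0.
Proof. by []. Qed.

Lemma incidenceDE (f g : incidence) x y : (f + g) x y = f x y + g x y.
Proof. by []. Qed.

Lemma incidence_scale_subproof (a : K) (f : incidence) :
  (fun x y => a * f x y) \in incidence_pred.
Proof. by apply/asboolP => x y /incidence_eq0 ->; rewrite mulr0. Qed.

Definition incidence_scale (a : K) (f : incidence) : incidence :=
  Incidence (incidence_scale_subproof a f).

Lemma incidence_scaleA a b f :
  incidence_scale a (incidence_scale b f) = incidence_scale (a * b) f.
Proof. by apply: incidence_ext => x y; rewrite /= mulrA. Qed.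

Lemma incidence_scale1 : left_id 1 incidence_scale.
Proof. by move=> f; apply: incidence_ext => x y; rewrite /= mul1r. Qed.

Lemma incidence_scaleDr : right_distributive incidence_scale +%R.
Proof. by move=> a f g; apply: incidence_ext => x y; rewrite /= mulrDr. Qed.

Lemma incidence_scaleDl f :
  {morph incidence_scale^~ f : a b / a + b >-> a + b}.
Proof. by move=> a b; apply: incidence_ext => x y; rewrite /= mulrDl. Qed.

HB.instance Definition _ := GRing.Zmodule_isLmodule.Build K incidence
  incidence_scaleA incidence_scale1 incidence_scaleDr incidence_scaleDl.

Lemma incidenceZE a (f : incidence) x y : (a *: f) x y = a * f x y.
Proof. by []. Qed.

(* A nonempty interval [u, v] is encoded by its pair of end points. *)
Definition finitary_pred : {pred incidence} :=
  fun f => `[< forall x y, (x <= y)%O ->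
    finite_set [set p : X * X |
      [/\ (x <= p.1)%O, (p.1 <= p.2)%O & (p.2 <= y)%O] /\
      p.1 != p.2 /\ f p.1 p.2 != 0] >].

Lemma finitary_submod_closed : subsemimod_closed finitary_pred.
Proof.
split; first split.
- apply/asboolP => x y _; rewrite (_ : [set _ | _] = set0) //.
  by apply/seteqP; split=> // p [_ [_]]; rewrite incidence0E eqxx.
- move=> f g /asboolP hf /asboolP hg; apply/asboolP => x y xy.
  apply: (@sub_finite_set _ _ (_ `|` _)); last first.
    by rewrite finite_setU; split; [apply: hf xy | apply: hg xy].
  move=> p [ip [np fg0]] /=; have [f0|f0] := eqVneq (f p.1 p.2) 0.
    by right; split => //; split => //; move: fg0; rewrite incidenceDE f0 add0r.
  by left.
- move=> a f /asboolP hf; apply/asboolP => x y xy.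
  apply: sub_finite_set (hf _ _ xy) => p [ip [np af0]]; split=> //; split=> //.
  by move: af0; rewrite incidenceZE mulf_eq0 => /norP[].
Qed.

HB.instance Definition _ :=
  GRing.isSubSemiModClosed.Build K incidence finitary_pred
    finitary_submod_closed.

Record finitary := Finitary {
  finitary_val :> incidence;
  finitaryP : finitary_val \in finitary_pred
}.

HB.instance Definition _ := [isSub for finitary_val].
HB.instance Definition _ := [Choice of finitary by <:].
HB.instance Definition _ := [SubChoice_isSubLmodule of finitary by <:].

Lemma finitary_ext (f g : finitary) : (forall x y, f x y = g x y) -> f = g.
Proof. by move=> fg; apply/val_inj/incidence_ext. Qed.

Lemma finitary0E x y : (0 : finitary) x y = 0.
Proof. by []. Qed.

Lemma finitaryDE (f g : finitary) x y : (f + g) x y = f x y + g x y.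
Proof. by []. Qed.

Lemma finitaryZE a (f : finitary) x y : (a *: f) x y = a * f x y.
Proof. by []. Qed.

(* The sum is over the z with nonzero summand, and is 0 by convention if there
   are infinitely many such z; this cannot happen if f or g is finitary. *)
Definition conv_fun (f g : X -> X -> K) : X -> X -> K := fun x y =>
  \sum_(z \in [set z | (x <= z)%O /\ (z <= y)%O]) f x z * g z y.

Lemma conv_subproof (f g : incidence) : conv_fun f g \in incidence_pred.
Proof.
apply/asboolP => x y nxy; rewrite /conv_fun fsbig1 // => z [xz zy].
by move: nxy; rewrite (le_trans xz zy).
Qed.

Definition conv (f g : incidence) : incidence := Incidence (conv_subproof f g).

Lemma conv_seq (f g : incidence) (r : seq X) x y :
    uniq r -> (forall z, f x z * g z y != 0 -> z \in r) ->
  conv f g x y = \sum_(z <- r) f x z * g z y.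
Proof.
move=> ur supr; rewrite /= /conv_fun [RHS]fsbig_seq // [LHS]fsbig_supp [RHS]fsbig_supp.
apply: eq_fsbigl; apply/seteqP; split=> z /= [] h fg0; split => //.
  by apply/supr/eqP.
move/eqP: fg0; rewrite mulf_eq0 => /norP[/incidence_le ? /incidence_le ?].
by split.
Qed.

Lemma finite_uniq_seq (S : set X) : finite_set S ->
  exists r : seq X, uniq r /\ forall z, S z -> z \in r.
Proof.
move=> /finite_seqP[s ->]; exists (undup s).
by rewrite undup_uniq; split=> // z; rewrite mem_undup.
Qed.

Lemma finitary_fin (f : finitary) x y : (x <= y)%O ->
  finite_set [set p : X * X |
      [/\ (x <= p.1)%O, (p.1 <= p.2)%O & (p.2 <= y)%O] /\
      p.1 != p.2 /\ f p.1 p.2 != 0].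
Proof. by move: x y; apply/asboolP; case: f. Qed.

Lemma finitary_finr (f : finitary) x y :
  finite_set [set z | (z <= y)%O /\ f x z != 0].
Proof.
have [xy|nxy] := boolP (x <= y)%O; last first.
  rewrite (_ : [set _ | _] = set0) //; apply/seteqP; split => // z [zy].
  by move/incidence_le => xz; move: nxy; rewrite (le_trans xz zy).
apply: (@sub_finite_set _ _ ([set x] `|` snd @` _)); last first.
  rewrite finite_setU; split=> //.
  exact: finite_image (finitary_fin f xy).
move=> z [zy fxz]; have xz := incidence_le fxz; have [->|nzx] := eqVneq z x.
  by left.
by right; exists (x, z) => //=; split=> //; split=> //; rewrite eq_sym.
Qed.

Lemma finitary_finl (f : finitary) x y :
  finite_set [set z | (x <= z)%O /\ f z y != 0].
Proof.
have [xy|nxy] := boolP (x <= y)%O; last first.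
  rewrite (_ : [set _ | _] = set0) //; apply/seteqP; split => // z [xz].
  by move/incidence_le => zy; move: nxy; rewrite (le_trans xz zy).
apply: (@sub_finite_set _ _ ([set y] `|` fst @` _)); last first.
  rewrite finite_setU; split=> //.
  exact: finite_image (finitary_fin f xy).
move=> z [xz fzy]; have zy := incidence_le fzy; have [->|nzy] := eqVneq z y.
  by left.
by right; exists (z, y) => //=; split.
Qed.

Lemma conv_neq0 (f g : incidence) x y : conv f g x y != 0 ->
  exists z, f x z != 0 /\ g z y != 0.
Proof.
apply: contraPP => /forallNP nz; apply/negP; rewrite negbK /= /conv_fun.
rewrite fsbig1 // => z _; apply/eqP; rewrite mulf_eq0; apply/negPn/negP.
by move=> /norP[fz gz]; apply: (nz z).
Qed.

Lemma finitary_mul_subproof (f g : finitary) : conv f g \in finitary_pred.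
Proof.
apply/asboolP => x y xy.
have Ff := finitary_fin f xy; have Fg := finitary_fin g xy.
set F := [set p | _] in Ff; set G := [set p | _] in Fg.
apply: (@sub_finite_set _ _ (F `|` (G `|` (fst @` F) `*` (snd @` G)))).
  move=> [u v] /= [[xu uv vy]] [nuv] /conv_neq0[z [fz gz]].
  have uz := incidence_le fz; have zv := incidence_le gz.
  have [zu|nzu] := eqVneq u z; first by right; left; rewrite -zu in gz.
  have [zv'|nzv] := eqVneq z v; first by left; rewrite zv' in fz.
  right; right; split=> /=.
    by exists (u, z) => //; split => //; split => //=; exact: le_trans vy.
  by exists (z, v) => //; split => //; split => //=; exact: le_trans uz.
rewrite !finite_setU; split=> //; split=> //.
by apply: finite_setX; apply: finite_image.
Qed.

Definition finitary_mul (f g : finitary) : finitary :=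
  Finitary (finitary_mul_subproof f g).

Lemma diag_incidence_subproof (e : X -> K) :
  (fun x y => if x == y then e x else 0) \in incidence_pred.
Proof. by apply/asboolP => x y; case: eqVneq => // ->; rewrite lexx. Qed.

Lemma diag_subproof (e : X -> K) :
  Incidence (diag_incidence_subproof e) \in finitary_pred.
Proof.
apply/asboolP => x y _; rewrite (_ : [set _ | _] = set0) //.
by apply/seteqP; split=> // p [_ [/negPf npq]] /=; rewrite npq eqxx.
Qed.

Definition diag (e : X -> K) : finitary := Finitary (diag_subproof e).

Lemma diagE e x y : diag e x y = if x == y then e x else 0.
Proof. by []. Qed.

Lemma conv_diagl e (g : incidence) x y : conv (diag e) g x y = e x * g x y.
Proof.
rewrite (@conv_seq _ _ [:: x]) // ?big_seq1 ?diagE ?eqxx // => z.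
by rewrite inE diagE [x == z]eq_sym; apply: contraR => /negPf ->; rewrite mul0r.
Qed.

Lemma conv_diagr e (g : incidence) x y : conv g (diag e) x y = g x y * e y.
Proof.
rewrite (@conv_seq _ _ [:: y]) // ?big_seq1 ?diagE ?eqxx // => z.
by rewrite inE diagE; apply: contraR => /negPf ->; rewrite mulr0.
Qed.

Lemma conv_assoc (f g : finitary) (h : incidence) :
  conv f (conv g h) = conv (conv f g) h.
Proof.
apply: incidence_ext => x y.
pose A := [set z | (z <= y)%O /\ f x z != 0].
pose C (w : X) := [set z | (z <= y)%O /\ g w z != 0].
have fA : finite_set A := finitary_finr f x y.
have fB : finite_set (\bigcup_(w in A) C w).
  by apply: bigcup_finite => // w _; exact: finitary_finr.
have [ra [ua inA]] := finite_uniq_seq fA.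
have [rb [ub inB]] := finite_uniq_seq fB.
have step1 : conv f (conv g h) x y =
    \sum_(w <- ra) \sum_(z <- rb) f x w * (g w z * h z y).
  rewrite (@conv_seq _ _ ra) //.
    apply: eq_bigr => w _; rewrite -mulr_sumr.
    have [->|fw] := eqVneq (f x w) 0; first by rewrite !mul0r.
    congr (_ * _); apply: conv_seq => // z.
    rewrite mulf_eq0 => /norP[gz hz]; apply: inB; exists w.
      split=> //; exact: le_trans (incidence_le gz) (incidence_le hz).
    by split=> //; exact: incidence_le hz.
  move=> w; rewrite mulf_eq0 => /norP[fw gh]; apply: inA; split=> //.
  exact: incidence_le gh.
have step2 : conv (conv f g) h x y =
    \sum_(z <- rb) \sum_(w <- ra) f x w * g w z * h z y.
  rewrite (@conv_seq _ _ rb) //.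
    apply: eq_bigr => z _; rewrite -mulr_suml.
    have [->|hz] := eqVneq (h z y) 0; first by rewrite !mulr0.
    congr (_ * _); apply: conv_seq => // w.
    rewrite mulf_eq0 => /norP[fw gw]; apply: inA; split=> //.
    exact: le_trans (incidence_le gw) (incidence_le hz).
  move=> z; rewrite mulf_eq0 => /norP[/conv_neq0[w [fw gw]] hz].
  have zy := incidence_le hz; apply: inB; exists w; split=> //.
  exact: le_trans (incidence_le gw) zy.
rewrite step1 step2 exchange_big; apply: eq_bigr => z _.
by apply: eq_bigr => w _; rewrite mulrA.
Qed.

Lemma finitary_mulE (f g : finitary) x y (r : seq X) :
    uniq r -> (forall z, (z <= y)%O -> f x z != 0 -> z \in r) ->
  finitary_mul f g x y = \sum_(z <- r) f x z * g z y.
Proof.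
move=> ur supr; apply: conv_seq => // z; rewrite mulf_eq0 => /norP[fz gz].
exact: supr (incidence_le gz) fz.
Qed.

Lemma finitary_mulEl (f g : finitary) x y (r : seq X) :
    uniq r -> (forall z, (x <= z)%O -> g z y != 0 -> z \in r) ->
  finitary_mul f g x y = \sum_(z <- r) f x z * g z y.
Proof.
move=> ur supr; apply: conv_seq => // z; rewrite mulf_eq0 => /norP[fz gz].
exact: supr (incidence_le fz) gz.
Qed.

Lemma finitary_mulA : associative finitary_mul.
Proof. by move=> f g h; apply/val_inj/conv_assoc. Qed.

Lemma finitary_mul1l : left_id (diag (fun=> 1)) finitary_mul.
Proof. by move=> f; apply: finitary_ext => x y; rewrite conv_diagl mul1r. Qed.

Lemma finitary_mul1r : right_id (diag (fun=> 1)) finitary_mul.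
Proof. by move=> f; apply: finitary_ext => x y; rewrite conv_diagr mulr1. Qed.

Lemma finitary_mulDl : left_distributive finitary_mul +%R.
Proof.
move=> f g h; apply: finitary_ext => x y; rewrite finitaryDE.
have [r [ur inr]] := finite_uniq_seq (finitary_finl h x y).
rewrite !(@finitary_mulEl _ _ _ _ r) //; try by move=> z *; apply: inr.
by rewrite -big_split; apply: eq_bigr => z _; rewrite finitaryDE mulrDl.
Qed.

Lemma finitary_mulDr : right_distributive finitary_mul +%R.
Proof.
move=> f g h; apply: finitary_ext => x y; rewrite finitaryDE.
have [r [ur inr]] := finite_uniq_seq (finitary_finr f x y).
rewrite !(@finitary_mulE _ _ _ _ r) //; try by move=> z *; apply: inr.
by rewrite -big_split; apply: eq_bigr => z _; rewrite finitaryDE mulrDr.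
Qed.

HB.instance Definition _ := GRing.Zmodule_isPzRing.Build finitary
  finitary_mulA finitary_mul1l finitary_mul1r finitary_mulDl finitary_mulDr.

Lemma finitary_scalerAl (a : K) (f g : finitary) : a *: (f * g) = (a *: f) * g.
Proof.
apply: finitary_ext => x y; rewrite finitaryZE.
have [r [ur inr]] := finite_uniq_seq (finitary_finl g x y).
rewrite !(@finitary_mulEl _ _ _ _ r) //; try by move=> z *; apply: inr.
by rewrite mulr_sumr; apply: eq_bigr => z _; rewrite finitaryZE mulrA.
Qed.

Lemma finitary_scalerAr (a : K) (f g : finitary) : a *: (f * g) = f * (a *: g).
Proof.
apply: finitary_ext => x y; rewrite finitaryZE.
have [r [ur inr]] := finite_uniq_seq (finitary_finr f x y).
rewrite !(@finitary_mulE _ _ _ _ r) //; try by move=> z *; apply: inr.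
by rewrite mulr_sumr; apply: eq_bigr => z _; rewrite finitaryZE mulrCA.
Qed.

(* MathComp's algType excludes the zero ring, which finitary is when X is empty;
   so finitary is equipped with its pzRingType and lmodType structures, which
   are compatible by finitary_scalerAl and finitary_scalerAr. *)

Record alg_unit := AlgUnit {
  alg_unit_val : finitary;
  alg_unit_inv : finitary;
  alg_unitVr : alg_unit_val * alg_unit_inv = 1;
  alg_unitVl : alg_unit_inv * alg_unit_val = 1
}.

Definition conj_by (u : alg_unit) (a : finitary) : finitary :=
  alg_unit_val u * a * alg_unit_inv u.

Definition is_inner (psi : finitary -> finitary) : Prop :=
  exists u : alg_unit, forall a, psi a = conj_by u a.

Record alg_aut := AlgAut {
  alg_aut_fun :> finitary -> finitary;
  alg_aut_linear : linear alg_aut_fun;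
  alg_aut_morphism : monoid_morphism alg_aut_fun;
  alg_aut_bij : bijective alg_aut_fun
}.

(* Bijectivity and preservation of 1 follow from the last two fields. *)
Record alg_involution := AlgInvolution {
  alg_inv_fun :> finitary -> finitary;
  alg_inv_linear : linear alg_inv_fun;
  alg_inv_antimorph : forall a b,
    alg_inv_fun (a * b) = alg_inv_fun b * alg_inv_fun a;
  alg_invK : involutive alg_inv_fun
}.

Definition alg_equiv (phi phi' : alg_involution) : Prop :=
  exists psi : alg_aut, psi \o phi =1 phi' \o psi.

Definition inner_equiv (phi phi' : alg_involution) : Prop :=
  exists psi : alg_aut, is_inner psi /\ psi \o phi =1 phi' \o psi.

Lemma mult_incidence_subproof (s : incidence) (f : finitary) :
  (fun x y => s x y * f x y) \in incidence_pred.
Proof.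
by apply/asboolP => x y nxy; rewrite (incidence_eq0 f) // mulr0.
Qed.

Lemma mult_subproof (s : incidence) (f : finitary) :
  Incidence (mult_incidence_subproof s f) \in finitary_pred.
Proof.
apply/asboolP => x y xy; apply: sub_finite_set (finitary_fin f xy).
by move=> p [ip [np]]; rewrite /= mulf_eq0 => /norP[].
Qed.

Definition mult_map (s : incidence) (f : finitary) : finitary :=
  Finitary (mult_subproof s f).

Definition multiplicative_elt (s : incidence) : Prop :=
  (forall x y, (x <= y)%O -> s x y != 0) /\
  (forall x y z, (x <= y)%O -> (y <= z)%O -> s x y * s y z = s x z).

Definition mult_auts_inner : Prop :=
  forall s : incidence, multiplicative_elt s -> is_inner (mult_map s).

Definition is_derivation (D : finitary -> incidence) : Prop :=
  linear D /\ forall f g : finitary, D (f * g) = conv (D f) g + conv f (D g).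

Definition inner_derivation (D : finitary -> incidence) : Prop :=
  exists i : incidence, forall f : finitary, D f = conv f i - conv i f.

Definition derivations_inner : Prop :=
  forall D : finitary -> incidence, is_derivation D -> inner_derivation D.

End IncidenceSpace.

Section Involutions.
Variables (K : fieldType) (d : Order.disp_t) (X : porderType d).
Variable lam : poset_involution X.
Local Notation FI := (finitary K X).

Lemma rho_incidence_subproof (f : FI) :
  (fun x y => f (lam y) (lam x)) \in @incidence_pred K d X.
Proof.
by apply/asboolP => x y nxy; apply: incidence_eq0; rewrite -poset_inv_le.
Qed.

Lemma rho_subproof (f : FI) :
  Incidence (rho_incidence_subproof f) \in @finitary_pred K d X.
Proof.
apply/asboolP => x y; rewrite (poset_inv_le lam) => xy.
apply: (@sub_finite_set _ _ ((fun p => (lam p.2, lam p.1)) @` _)); last first.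
  exact: finite_image (finitary_fin f xy).
move=> [u v] /= [[xu uv vy] [nuv fuv]].
exists (lam v, lam u); last by rewrite /= !poset_invK.
rewrite /= -!poset_inv_le; split=> //; split=> //.
by rewrite (can_eq (poset_invK lam)) eq_sym.
Qed.

Definition rho (f : FI) : FI := Finitary (rho_subproof f).

Lemma rhoE f x y : rho f x y = f (lam y) (lam x).
Proof. by []. Qed.

Lemma rho_linear : linear rho.
Proof. by move=> a f g; apply: finitary_ext. Qed.

Lemma rhoK : involutive rho.
Proof. by move=> f; apply: finitary_ext => x y; rewrite !rhoE !poset_invK. Qed.

Lemma rhoM f g : rho (f * g) = rho g * rho f.
Proof.
apply: finitary_ext => x y; rewrite rhoE.
have [r [ur inr]] := finite_uniq_seq (finitary_finr f (lam y) (lam x)).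
rewrite (@finitary_mulE _ _ _ _ _ _ _ r) //; last by move=> z *; apply: inr.
rewrite (@finitary_mulEl _ _ _ _ _ _ _ (map lam r)).
- rewrite big_map; apply: eq_bigr => z _.
  by rewrite !rhoE !poset_invK mulrC.
- by rewrite map_inj_uniq //; exact: (can_inj (poset_invK lam)).
- move=> z xz; rewrite rhoE => fz; rewrite -[z](poset_invK lam).
  by apply/map_f/inr; split=> //; rewrite -poset_inv_le.
Qed.

Definition nonzero := {a : K | a != 0}.

Variable eps : fixpts lam -> nonzero.

Definition eps_ext (x : X) : K :=
  if insub x is Some z then val (eps z) else 1.

Lemma eps_ext_neq0 x : eps_ext x != 0.
Proof.
rewrite /eps_ext; case: insub => [z|]; [exact: (valP (eps z)) | exact: oner_neq0].
Qed.

Lemma eps_ext_lam x : eps_ext (lam x) = eps_ext x.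
Proof.
have [fx|nfx] := eqVneq (lam x) x; first by rewrite fx.
rewrite /eps_ext !insubN //; apply/eqP; rewrite (poset_invK lam) => fx.
by rewrite -fx eqxx in nfx.
Qed.

Lemma u_eps_rV : diag eps_ext * diag (fun x => (eps_ext x)^-1) = 1 :> FI.
Proof.
apply: finitary_ext => x y; rewrite [LHS]conv_diagl !diagE.
by case: eqVneq => _; rewrite ?mulr0 // mulfV // eps_ext_neq0.
Qed.

Lemma u_eps_lV : diag (fun x => (eps_ext x)^-1) * diag eps_ext = 1 :> FI.
Proof.
apply: finitary_ext => x y; rewrite [LHS]conv_diagl !diagE.
by case: eqVneq => [->|_]; rewrite ?mulr0 // mulVf // eps_ext_neq0.
Qed.

Definition u_eps : alg_unit K X := AlgUnit u_eps_rV u_eps_lV.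

Definition rho_eps_fun (f : FI) : FI := conj_by u_eps (rho f).

Lemma rho_eps_funE f x y :
  rho_eps_fun f x y = eps_ext x * f (lam y) (lam x) * (eps_ext y)^-1.
Proof. by rewrite [LHS]conv_diagr [X in X * _]conv_diagl rhoE. Qed.

Lemma rho_eps_linear : linear rho_eps_fun.
Proof.
move=> a f g; apply: finitary_ext => x y.
by rewrite finitaryDE finitaryZE !rho_eps_funE finitaryDE finitaryZE mulrDr mulrDl
  mulrCA !mulrA.
Qed.

Lemma rho_epsM f g : rho_eps_fun (f * g) = rho_eps_fun g * rho_eps_fun f.
Proof.
rewrite /rho_eps_fun /conj_by rhoM !mulrA -[_ * alg_unit_inv u_eps * alg_unit_val u_eps]mulrA.
by rewrite alg_unitVl mulr1.
Qed.

Lemma rho_epsK : involutive rho_eps_fun.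
Proof.
move=> f; apply: finitary_ext => x y.
rewrite !rho_eps_funE !poset_invK !eps_ext_lam [X in X / _]mulrC.
by rewrite mulfVK ?eps_ext_neq0 // mulrAC mulfV ?eps_ext_neq0 // mul1r.
Qed.

Definition rho_eps : alg_involution K X :=
  AlgInvolution rho_eps_linear rho_epsM rho_epsK.

End Involutions.

(* Main.v *)
Require Import Defs.
From HB Require Import structures.
From mathcomp Require Import all_boot all_order all_algebra.
From mathcomp Require Import all_classical.

(** Write e_x for the primitive idempotent of the point x.  Up to an inner
    automorphism, every automorphism psi of FI(X, K) is induced by an
    automorphism alpha of X, and the theorem is a computation with this fact.

    Construction of alpha.  An idempotent with zero diagonal vanishes, because
    a nonzero entry would start an infinite chain inside the finite support of
    a column.  Hence psi(e_x), whose Peirce corner is one-dimensional, has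
    exactly one nonzero diagonal entry, at a point alpha(x); this defines a
    poset automorphism (alg_aut_poset_aut).

    Reduction to inner automorphisms.  Composing psi with the pullback
    f |-> f(alpha -, alpha -) gives an automorphism phi such that
    phi(e_x)(x, x) = 1 for all x.  Let u be the function whose column at y is
    that of phi(e_y).  The crux is that u is finitary (first_cols_subproof):
    otherwise one could choose a subset S of X such that the idempotent
    phi(1_S), where 1_S is the diagonal indicator of S, has infinitely many
    nonzero entries off the diagonal in some interval.  One has
    phi(e_y) u = u e_y; if u' is built likewise from the inverse of phi, then
    phi(u') inverts u.  So phi is conjugate to an automorphism that fixes all
    the e_x, which is multiplicative (fix_munits_mult), hence inner by
    hypothesis.  Thus phi is inner (fixes_points_inner).

    Conclusion.  If psi intertwines rho_eps1 and rho_eps2, then comparing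
    diagonal entries shows that alpha commutes with lambda.  The pullback along
    alpha carries rho_eps2 to rho_(eps2 o alpha) (pullback_rho_eps), so the
    inner automorphism phi intertwines rho_eps1 and rho_(eps2 o alpha).
    The converse uses the same pullback. *)
Local Open Scope ring_scope.

Set Implicit Arguments.
Unset Strict Implicit.
Unset Printing Implicit Defensive.

Import Order.TTheory GRing.Theory.
Local Open Scope classical_set_scope.

(** * Infinite sets *)

Lemma seq_maximal (d : Order.disp_t) (X : porderType d) (a : X) (r : seq X) :
  exists2 m, m \in a :: r & forall y, y \in a :: r -> ~~ (m < y)%O.
Proof.
elim: r a => [|b r IHr] a.
  by exists a => [|y]; rewrite inE // => /eqP ->; rewrite ltxx.
have [m mr maxm] := IHr b.
have [ma|nma] := boolP (m < a)%O.
  exists a; first exact: mem_head.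
  move=> y; rewrite inE => /predU1P[->|/maxm]; first by rewrite ltxx.
  by apply: contra; exact: lt_trans.
exists m; first by rewrite inE mr orbT.
by move=> y; rewrite inE => /predU1P[->|/maxm].
Qed.

Lemma finite_no_max (d : Order.disp_t) (X : porderType d) (S : set X) :
  finite_set S -> (forall x, S x -> exists2 y, S y & (x < y)%O) ->
  S = set0.
Proof.
move=> /finite_seqP[[|a r] ->] up; first by apply/seteqP; split.
have [m mr maxm] := seq_maximal a r.
by have [y /maxm/negP] := up m mr.
Qed.

(** A finite-to-one map without fixed points on an infinite set W sends some
    infinite subset of W outside itself: a maximal subset S with f(S) disjoint
    from S works, since if it were finite, all but finitely many points of W
    could be added to it. *)
Lemma infinite_free_subset (T : choiceType) (W : set T) (f : T -> T) :
  infinite_set W -> (forall w, W w -> f w <> w) ->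
  (forall y, finite_set (W `&` f @^-1` [set y])) ->
  exists S, [/\ S `<=` W, infinite_set S & forall w, S w -> ~ S (f w)].
Proof.
move=> infW fW fibW.
pose P (S : set T) := S `<=` W /\ forall w, S w -> ~ S (f w).
have [F FP totF|S [[SW freeS] maxS]] := @Zorn_bigcup T P.
  split=> [w [A FA Aw]|w [A FA Aw] [B FB Bfw]]; first exact: (FP A FA).1 Aw.
  have [AB|BA] := totF A B FA FB.
    exact: (FP B FB).2 (AB _ Aw) Bfw.
  exact: (FP A FA).2 Aw (BA _ Bfw).
exists S; split=> // finS.
(* The points that cannot be added to S. *)
pose N := S `|` (f @` S `|` \bigcup_(y in S) (W `&` f @^-1` [set y])).
have finN : finite_set N.
  rewrite /N !finite_setU; split=> //; split; first exact: finite_image.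
  exact: bigcup_finite.
have [w [Ww nNw]] : W `\` N !=set0.
  apply/set0P/eqP => WN0; apply: (infinite_setD infW finN).
  by rewrite WN0.
apply: (maxS (S `|` [set w])).
  split; first by left.
  by move=> /(_ w (or_intror erefl)) Sw; apply: nNw; left.
split=> [z [/SW//|->//]|z [Sz|->] [Sfz|fzw]].
- exact: freeS Sz Sfz.
- by apply: nNw; right; left; exists z.
- by apply: nNw; right; right; exists (f w).
- exact: fW Ww fzw.
Qed.

(** * Matrix units *)

Section Algebra.
Variables (K : fieldType) (d : Order.disp_t) (X : porderType d).
Local Notation FI := (finitary K X).
Implicit Types (f g : FI) (x y z a b : X).

Lemma munit_incidence_subproof x y :
  (fun u v => [&& (x <= y)%O, u == x & v == y]%:R) \in @incidence_pred K d X.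
Proof.
by apply/asboolP => u v; case: and3P => // -[xy /eqP-> /eqP->]; rewrite xy.
Qed.

Lemma munit_subproof x y :
  Incidence (munit_incidence_subproof x y) \in @finitary_pred K d X.
Proof.
apply/asboolP => u v _; apply: (@sub_finite_set _ _ [set (x, y)]) => //.
move=> [w z] [_ [_]] /=.
by case: and3P => [[_ /eqP-> /eqP->]|]; rewrite ?eqxx.
Qed.

(** The matrix unit at (x, y), which is 0 unless x <= y; the diagonal ones are
    the primitive idempotents of the points of X. *)
Definition munit x y : FI := Finitary (munit_subproof x y).

Lemma munitE x y u v :
  munit x y u v = [&& (x <= y)%O, u == x & v == y]%:R.
Proof. by []. Qed.

Lemma munit_id x y : (x <= y)%O -> munit x y x y = 1.
Proof. by move=> xy; rewrite munitE xy !eqxx. Qed.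

Lemma munit_idxx x : munit x x x x = 1.
Proof. exact: munit_id. Qed.

Lemma mul_neq0 f g x y : (f * g) x y != 0 -> exists z, f x z != 0 /\ g z y != 0.
Proof. exact: conv_neq0. Qed.

(** A convolution sum with at most one nonzero term, at z. *)
Lemma mulE1 z f g x y :
    (forall w, f x w != 0 -> g w y != 0 -> w = z) ->
  (f * g) x y = f x z * g z y.
Proof.
move=> supp; have := @conv_seq _ _ _ f g [:: z] x y; rewrite big_seq1.
apply=> //.
by move=> w; rewrite mulf_eq0 inE => /norP[fw gw]; rewrite (supp w).
Qed.

Lemma mul_diag_eq f g x : (f * g) x x = f x x * g x x.
Proof.
apply: mulE1 => w /incidence_le xw /incidence_le wx.
by apply: le_anti; rewrite wx.
Qed.

Lemma mul_munitr f x y u v : (f * munit x y) u v = f u x * munit x y x v.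
Proof.
by apply: mulE1 => w _; rewrite munitE; case: and3P => [[_ /eqP]|];
  rewrite ?eqxx.
Qed.

Lemma mul_munitl f x y u v : (munit x y * f) u v = munit x y u y * f y v.
Proof.
by apply: mulE1 => w + _; rewrite munitE; case: and3P => [[_ _ /eqP]|];
  rewrite ?eqxx.
Qed.

Lemma mul_munit x y z :
  (x <= y)%O -> (y <= z)%O -> munit x y * munit y z = munit x z.
Proof.
move=> xy yz; apply: finitary_ext => u v.
by rewrite mul_munitr !munitE xy yz (le_trans xy yz) eqxx /= andbT -natrM mulnb.
Qed.

Lemma munit_orth x y : x != y -> munit x x * munit y y = 0.
Proof.
move=> xy; apply: finitary_ext => u v; rewrite mul_munitr munitE.
by rewrite [y == x]eq_sym (negPf xy) !andbF mul0r.
Qed.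

Lemma peirce f x y : munit x x * f * munit y y = f x y *: munit x y.
Proof.
apply: finitary_ext => u v; rewrite finitaryZE mul_munitr mul_munitl !munitE.
rewrite !lexx !eqxx /= andbT.
have [xy|/(incidence_eq0 f) ->] := boolP (x <= y)%O.
  by rewrite mulrAC mulrC -natrM mulnb.
by rewrite mulr0 !mul0r.
Qed.

Lemma mul_munit_diagr f a u v : (f * munit a a * f) u v = f u a * f a v.
Proof.
rewrite (@mulE1 a) => [|w]; first by rewrite mul_munitr munit_idxx mulr1.
by rewrite mul_munitr munitE; case: and3P => [[_ _ /eqP]|];
  rewrite ?mulr0 ?eqxx.
Qed.

Lemma incidence_antisym f a b : a != b -> f a b * f b a = 0.
Proof.
have [ab|/(incidence_eq0 f) ->] := boolP (a <= b)%O; last by rewrite mul0r.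
have [ba|/(incidence_eq0 f) ->] := boolP (b <= a)%O; last by rewrite mulr0.
by case/eqP; apply: le_anti; rewrite ab.
Qed.

Lemma munit_neq0 x y : (x <= y)%O -> munit x y <> 0.
Proof.
move=> xy m0; have := munit_id xy; rewrite m0 finitary0E => /esym/eqP.
by rewrite oner_eq0.
Qed.

Lemma finitary_ext_col f g : (forall y, f * munit y y = g * munit y y) -> f = g.
Proof.
move=> fg; apply: finitary_ext => x y.
by have /(congr1 (fun h : FI => h x y)) := fg y;
  rewrite !mul_munitr munit_idxx !mulr1.
Qed.

(** * Idempotents *)

Lemma idem_diag0 g : g * g = g -> (forall x, g x x = 0) -> g = 0.
Proof.
move=> gg g0; apply: finitary_ext => p q; rewrite finitary0E.
(* As g = g * g, a nonzero entry g z q forces a nonzero g w q with z < w. *)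
pose S := [set z | (p <= z)%O /\ g z q != 0].
apply: contrapT => /eqP gpq.
suff S0 : S = set0 by have : S p by []; rewrite S0.
apply: finite_no_max; first exact: finitary_finl.
move=> z [pz]; rewrite -{1}gg => /mul_neq0[w [gzw gwq]]; exists w.
  by split=> //; exact: le_trans pz (incidence_le gzw).
rewrite lt_neqAle (incidence_le gzw) andbT.
by apply: contraNneq gzw => <-; rewrite g0.
Qed.

Lemma idem_diag1 g : g * g = g -> (forall x, g x x = 1) -> g = 1.
Proof.
move=> gg g1; apply/eqP; rewrite eq_sym -subr_eq0; apply/eqP/idem_diag0.
  by rewrite mulrBl mul1r mulrBr mulr1 gg subrr subr0.
move=> x; have -> : (1 - g) x x = (1 : FI) x x - g x x by [].
by rewrite g1 diagE eqxx subrr.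
Qed.

(** g is a nonzero idempotent whose Peirce corner g FI g consists of its scalar
    multiples. *)
Definition rank1_idem g :=
  [/\ g * g = g, g <> 0 & forall f, exists c : K, g * f * g = c *: g].

Lemma munit_rank1 x : rank1_idem (munit x x).
Proof.
split; [exact: mul_munit|exact: munit_neq0|].
by move=> f; exists (f x x); exact: peirce.
Qed.

Lemma rank1_diag g : rank1_idem g -> exists a, g a a = 1.
Proof.
move=> [gg g0 _]; apply: contrapT => /forallNP na; apply/g0/idem_diag0 => // a.
have : g a a * g a a = g a a by rewrite -mul_diag_eq gg.
move/eqP; rewrite -subr_eq0 -{3}[g a a]mulr1 -mulrBr mulf_eq0 subr_eq0.
by case/orP=> /eqP // /na.
Qed.

Lemma rank1_factor g a : rank1_idem g -> g a a = 1 -> g * munit a a * g = g.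
Proof.
move=> [_ _ gK] ga; have [c gc] := gK (munit a a); rewrite gc.
have /(congr1 (fun h : FI => h a a)) := gc.
by rewrite mul_munit_diagr finitaryZE ga !mulr1 => <-; rewrite scale1r.
Qed.

(** The entry at (b, b) of g e_a g = g is g b a * g a b, which is 0 unless
    a = b. *)
Lemma rank1_diag_uniq g a b : rank1_idem g -> g a a = 1 -> g b b = 1 -> a = b.
Proof.
move=> rg ga gb.
have /(congr1 (fun h : FI => h b b)) := rank1_factor rg ga.
rewrite mul_munit_diagr gb => /eqP; apply: contraTeq => ab.
by rewrite mulrC incidence_antisym // eq_sym oner_eq0.
Qed.

(** * Automorphisms of the algebra *)

Section AutTheory.
Variable psi : alg_aut K X.

Lemma alg_autM f g : psi (f * g) = psi f * psi g.
Proof. exact: (alg_aut_morphism psi).2. Qed.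

Lemma alg_aut1 : psi 1 = 1.
Proof. exact: (alg_aut_morphism psi).1. Qed.

Lemma alg_aut0 : psi 0 = 0.
Proof.
by have := alg_aut_linear psi (-1) 0 0; rewrite !scaleN1r !addNr.
Qed.

Lemma alg_autZ c f : psi (c *: f) = c *: psi f.
Proof. by have := alg_aut_linear psi c f 0; rewrite alg_aut0 !addr0. Qed.

Lemma alg_aut_inj : injective psi.
Proof. exact: bij_inj (alg_aut_bij psi). Qed.

Lemma alg_aut_inverse :
  exists psi' : alg_aut K X, cancel psi psi' /\ cancel psi' psi.
Proof.
have [h psiK hK] := alg_aut_bij psi.
have h_lin : linear h.
  by move=> c f g; apply: alg_aut_inj; rewrite alg_aut_linear !hK.
have h_morph : monoid_morphism h.
  split; first by apply: alg_aut_inj; rewrite hK alg_aut1.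
  by move=> f g; apply: alg_aut_inj; rewrite alg_autM !hK.
by exists (AlgAut h_lin h_morph (Bijective hK psiK)).
Qed.

End AutTheory.

Lemma alg_aut_rank1 (psi : alg_aut K X) g : rank1_idem g -> rank1_idem (psi g).
Proof.
have [psi' [psiK psi'K]] := alg_aut_inverse psi.
move=> [gg g0 gK]; split=> [|/(congr1 psi')|f]; first by rewrite -alg_autM gg.
  by rewrite psiK alg_aut0.
have [c gc] := gK (psi' f); exists c.
by rewrite -alg_autZ -gc !alg_autM psi'K.
Qed.

Lemma alg_aut_comp (phi psi : alg_aut K X) :
  exists chi : alg_aut K X, chi =1 phi \o psi.
Proof.
have chi_lin : linear (phi \o psi) by move=> c f g; rewrite /= !alg_aut_linear.
have chi_morph : monoid_morphism (phi \o psi).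
  by split=> [|f g] /=; rewrite ?alg_aut1 // !alg_autM.
by exists (AlgAut chi_lin chi_morph
  (bij_comp (alg_aut_bij phi) (alg_aut_bij psi))).
Qed.

(** The inverse unit. *)
Definition alg_unit_rev (u : alg_unit K X) : alg_unit K X :=
  AlgUnit (alg_unitVl u) (alg_unitVr u).

Lemma conj_byK (u : alg_unit K X) :
  cancel (conj_by u) (conj_by (alg_unit_rev u)).
Proof.
move=> f; rewrite /conj_by /= !mulrA alg_unitVl mul1r -mulrA alg_unitVl.
by rewrite mulr1.
Qed.

Lemma conj_by_revK (u : alg_unit K X) :
  cancel (conj_by (alg_unit_rev u)) (conj_by u).
Proof. by case: u => u v uv vu; exact: (@conj_byK (AlgUnit vu uv)). Qed.

Lemma conj_aut (u : alg_unit K X) : exists chi : alg_aut K X, chi =1 conj_by u.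
Proof.
have chi_lin : linear (conj_by u).
  move=> c f g; rewrite /conj_by mulrDr mulrDl.
  by rewrite -finitary_scalerAr -finitary_scalerAl.
have chi_morph : monoid_morphism (conj_by u).
  split=> [|f g]; rewrite /conj_by; first by rewrite mulr1 alg_unitVr.
  by rewrite !mulrA -[_ * alg_unit_inv u * alg_unit_val u]mulrA alg_unitVl
    mulr1.
by exists (AlgAut chi_lin chi_morph
  (Bijective (@conj_byK u) (@conj_by_revK u))).
Qed.

(** * The induced automorphism of the poset *)

Lemma alg_aut_point (psi : alg_aut K X) x : exists a, psi (munit x x) a a = 1.
Proof. exact/rank1_diag/alg_aut_rank1/munit_rank1. Qed.

(** The point assignments of an automorphism and of its inverse are mutually
    inverse. *)
Lemma alg_aut_point_inv (psi psi' : alg_aut K X) x a b : cancel psi' psi ->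
  psi (munit x x) a a = 1 -> psi' (munit b b) x x = 1 -> a = b.
Proof.
move=> psi'K psix psi'b.
have /(congr1 psi) : munit x x * psi' (munit b b) * munit x x = munit x x.
  by rewrite peirce psi'b scale1r.
rewrite !alg_autM psi'K => /(congr1 (fun h : FI => h a a)).
rewrite mul_munit_diagr psix => /eqP; apply: contraTeq => ab.
by rewrite incidence_antisym // eq_sym oner_eq0.
Qed.

Lemma alg_aut_point_le (psi : alg_aut K X) x y a b :
    psi (munit x x) a a = 1 -> psi (munit y y) b b = 1 ->
  (x <= y)%O -> (a <= b)%O.
Proof.
move=> psia psib xy; apply: contraT => nab.
have rx := alg_aut_rank1 psi (munit_rank1 x).
have ry := alg_aut_rank1 psi (munit_rank1 y).
have : psi (munit x y) = 0.
  have -> : munit x y = munit x x * munit x y * munit y y.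
    by rewrite !mul_munit.
  rewrite !alg_autM -(rank1_factor rx psia) -(rank1_factor ry psib).
  (* With psi (e_x) = psi (e_x) e_a psi (e_x), the product factors through
     e_a FI e_b, which is 0. *)
  set gx := psi (munit x x); set gy := psi (munit y y); set m := psi _.
  have -> : gx * munit a a * gx * m * (gy * munit b b * gy) =
            gx * (munit a a * (gx * m * gy) * munit b b) * gy.
    by rewrite !mulrA.
  by rewrite peirce (incidence_eq0 _ nab) scale0r mulr0 mul0r.
by rewrite -(alg_aut0 psi) => /alg_aut_inj/(munit_neq0 xy).
Qed.

(** The automorphism of X induced by psi on the diagonal. *)
Lemma alg_aut_poset_aut (psi : alg_aut K X) :
  exists alpha : poset_aut X,
    forall x, psi (munit x x) (alpha x) (alpha x) = 1.
Proof.
have [psi' [psiK psi'K]] := alg_aut_inverse psi.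
have [alpha alphaP] := choice (alg_aut_point psi).
have [beta betaP] := choice (alg_aut_point psi').
have betaK : cancel beta alpha.
  by move=> y; apply: (alg_aut_point_inv psi'K (alphaP _)); exact: betaP.
have alphaK : cancel alpha beta.
  by move=> x; apply: (alg_aut_point_inv psiK (betaP _)); exact: alphaP.
have alpha_le x y : (x <= y)%O = (alpha x <= alpha y)%O.
  apply/idP/idP => [|h]; first exact: alg_aut_point_le.
  rewrite -[x]alphaK -[y]alphaK.
  exact: alg_aut_point_le (betaP _) (betaP _) h.
by exists (PosetAut alpha_le (Bijective alphaK betaK)).
Qed.

(** * Automorphisms that fix every point *)

(** The automorphism phi induces the identity of X. *)
Definition fixes_points (phi : alg_aut K X) : Prop :=
  forall x, phi (munit x x) x x = 1.

Section FixesPoints.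
Variable phi : alg_aut K X.
Hypothesis phiP : fixes_points phi.

Lemma fixes_points_diag f x : phi f x x = f x x.
Proof.
have /(congr1 phi) := peirce f x x.
rewrite !alg_autM alg_autZ => /(congr1 (fun h : FI => h x x)).
by rewrite !mul_diag_eq finitaryZE !phiP !mulr1 mul1r.
Qed.

Lemma fixes_points_inv (phi' : alg_aut K X) :
  cancel phi' phi -> fixes_points phi'.
Proof.
by move=> phi'K x; rewrite -fixes_points_diag phi'K munit_idxx.
Qed.

Lemma first_cols_incidence_subproof :
  (fun w y => phi (munit y y) w y) \in @incidence_pred K d X.
Proof. by apply/asboolP => w y; exact: incidence_eq0. Qed.

(** The indicator function of S, on the diagonal. *)
Let ind (S : set X) : FI := diag (fun x => (`[< S x >])%:R).

(** Expansion of phi (1_S) * phi (e_y) = phi (e_y) at (w, y): the term at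
    z = w vanishes because phi (1_S) has the diagonal of 1_S. *)
Lemma ind_step (S : set X) w y : ~ S w -> S y -> phi (munit y y) w y != 0 ->
  exists z, [/\ (w < z)%O, phi (ind S) w z != 0 & phi (munit y y) z y != 0].
Proof.
move=> Sw Sy; have Fg : phi (ind S) * phi (munit y y) = phi (munit y y).
  rewrite -alg_autM; congr (phi _); apply: finitary_ext => a b.
  rewrite [LHS]conv_diagl munitE; case: and3P => [[_ /eqP -> _]|].
    by rewrite asboolT // mulr1.
  by rewrite mulr0.
rewrite -{1}Fg => /mul_neq0[z [Fz gz]]; exists z; split=> //.
rewrite lt_neqAle (incidence_le Fz) andbT; apply: contraNneq Fz => <-.
by rewrite fixes_points_diag diagE eqxx asboolF.
Qed.

(** Inside an interval [p, q], only finitely many rows w contain a nonzero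
    off-diagonal entry of first_cols, and each such row has finitely many. *)
Lemma first_cols_subproof :
  Incidence first_cols_incidence_subproof \in @finitary_pred K d X.
Proof.
apply/asboolP => p q pq.
pose Y w := [set y | [/\ (w < y)%O, (y <= q)%O & phi (munit y y) w y != 0]].
pose W := [set w | (p <= w)%O /\ exists y, Y w y].
have finW : finite_set W.
  apply: contrapT => infW.
  (* Columns are finite, so choosing an entry in each row is finite-to-one; an
     infinite free set S of rows makes phi (1_(~ S)) not finitary. *)
  have /choice[f fP] w : exists y, W w -> Y w y.
    have [[_ [y wy]]|nW] := pselect (W w); first by exists y.
    by exists w.
  have [||S [SW infS freeS]] := infinite_free_subset infW (f := f).
  - by move=> w /fP[+ _ _]; move=> /[swap] ->; rewrite ltxx.
  - move=> y; apply: sub_finite_set (finitary_finl (phi (munit y y)) p y).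
    by move=> w [Ww fwy]; have [_ _] := fP _ Ww; rewrite fwy; case: Ww.
  apply: infS; have := finitary_fin (phi (ind (~` S))) pq.
  move=> /(finite_image fst); apply: sub_finite_set => w Sw.
  have [pw _] := SW w Sw; have [wfw fwq ufw] := fP w (SW w Sw).
  have nSw : ~ (~` S) w by exact.
  have [z [wz Fwz uz]] := ind_step nSw (freeS w Sw) ufw.
  exists (w, z) => //=; split; last by rewrite (lt_eqF wz).
  split=> //; first exact: ltW.
  exact: le_trans (incidence_le uz) fwq.
have finY w : W w -> finite_set (Y w).
  move=> Ww; apply: contrapT => infYw.
  (* Take w maximal in W with an infinite row, and expand by phi (1_(Y w)):
     all but finitely many y in Y w also lie in a row z > w of W. *)
  pose B := [set w | W w /\ infinite_set (Y w)].
  suff B0 : B = set0 by have : B w by []; rewrite B0.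
  apply: finite_no_max; first by apply: sub_finite_set finW => ? [].
  move=> {Ww infYw} w [Ww infYw]; apply: contrapT => noB.
  apply: infYw; pose F := phi (ind (Y w)).
  apply: (@sub_finite_set _ _ ([set z | (z <= q)%O /\ F w z != 0] `|`
            \bigcup_(z in W `&` [set z | (w < z)%O]) Y z)); last first.
    rewrite finite_setU; split; first exact: finitary_finr.
    apply: bigcup_finite; first exact: finite_setIl.
    move=> z [Wz wz]; apply: contrapT => infYz; apply: noB.
    by exists z.
  move=> y Ywy; have [wy yq uwy] := Ywy.
  have nYw : ~ Y w w by case; rewrite ltxx.
  have [z [wz Fwz uz]] := ind_step nYw Ywy uwy.
  have [zy|nzy] := eqVneq z y; first by left; rewrite -zy; rewrite -zy in yq.
  have Yzy : Y z y by split=> //; rewrite lt_neqAle nzy (incidence_le uz).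
  right; exists z => //; split=> //; split; last by exists y.
  by apply: le_trans (ltW wz); case: Ww.
apply: (@sub_finite_set _ _ (\bigcup_(w in W) ([set w] `*` Y w))); last first.
  by apply: bigcup_finite => // w Ww; apply: finite_setX => //; exact: finY.
move=> [w y] [[/= pw wy yq] [nwy uwy]].
have Ywy : Y w y by split=> //; rewrite lt_neqAle nwy.
by exists w => //; split=> //; exists y.
Qed.

(** The function whose column at y is the column at y of phi (e_y). *)
Definition first_cols : FI := Finitary first_cols_subproof.

Lemma first_colsE w y : first_cols w y = phi (munit y y) w y.
Proof. by []. Qed.

Lemma first_cols_munit y :
  first_cols * munit y y = phi (munit y y) * munit y y.
Proof.
by apply: finitary_ext => a b; rewrite !mul_munitr first_colsE.
Qed.

Lemma first_cols_intertwine y :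
  phi (munit y y) * first_cols = first_cols * munit y y.
Proof.
apply: finitary_ext_col => z; rewrite -!mulrA first_cols_munit mulrA -alg_autM.
have [<-|nyz] := eqVneq y z; first by rewrite !mul_munit // first_cols_munit.
by rewrite !munit_orth // alg_aut0 mul0r mulr0.
Qed.

End FixesPoints.

Lemma fixes_points_conj (phi : alg_aut K X) : fixes_points phi ->
  exists u : alg_unit K X, forall y, phi (munit y y) = conj_by u (munit y y).
Proof.
move=> phiP; have [phi' [phiK phi'K]] := alg_aut_inverse phi.
have phi'P := fixes_points_inv phiP phi'K.
(* phi' (e_y) u' = u' e_y becomes e_y v = v phi (e_y) for v = phi (u'), so that
   v * u commutes with every e_y and is therefore diagonal. *)
pose u := first_cols phiP; pose v := phi (first_cols phi'P).
have vE y : munit y y * v = v * phi (munit y y).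
  by rewrite -{1}[munit y y]phi'K -!alg_autM first_cols_intertwine.
have vu : v * u = 1.
  apply: finitary_ext => x y; rewrite diagE.
  have [<-|nxy] := eqVneq x y.
    rewrite mul_diag_eq first_colsE phiP mulr1 fixes_points_diag // first_colsE.
    exact: phi'P.
  have /(congr1 (fun h : FI => h x y)) : munit x x * (v * u) * munit y y = 0.
    rewrite mulrA vE -[v * _ * u]mulrA first_cols_intertwine -!mulrA.
    by rewrite munit_orth // !mulr0.
  by rewrite mul_munitr mul_munitl !munit_idxx mulr1 mul1r finitary0E.
(* u * v is an idempotent with unit diagonal. *)
have uv : u * v = 1.
  apply: idem_diag1 => [|x]; first by rewrite mulrA -[u * v * u]mulrA vu mulr1.
  by rewrite mul_diag_eq mulrC -mul_diag_eq vu diagE eqxx.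
exists (AlgUnit uv vu) => y.
by rewrite /conj_by /= -first_cols_intertwine -mulrA uv mulr1.
Qed.

Lemma fix_munits_mult (phi : alg_aut K X) :
    (forall x, phi (munit x x) = munit x x) ->
  exists2 s, multiplicative_elt s & forall f, phi f = mult_map s f.
Proof.
move=> phie; pose sf x y := phi (munit x y) x y.
have sP : sf \in @incidence_pred K d X.
  by apply/asboolP => x y; exact: incidence_eq0.
have phim x y : (x <= y)%O -> phi (munit x y) = sf x y *: munit x y.
  move=> xy; rewrite -peirce -(phie x) -(phie y) -!alg_autM.
  by rewrite !mul_munit.
exists (Incidence sP) => [|f].
  split=> [x y xy|x y z xy yz] /=.
    apply/eqP => s0; apply: (munit_neq0 xy); apply: (@alg_aut_inj phi).
    by rewrite phim // s0 scale0r alg_aut0.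
  have : phi (munit x y * munit y z) = sf x z *: munit x z.
    by rewrite mul_munit // phim // (le_trans xy yz).
  rewrite alg_autM !phim // -finitary_scalerAl -finitary_scalerAr mul_munit //.
  move=> /(congr1 (fun h : FI => h x z)); rewrite !finitaryZE.
  by rewrite munit_id ?(le_trans xy yz) // !mulr1.
apply: finitary_ext => x y; rewrite /= /sf.
have [xy|nxy] := boolP (x <= y)%O; last by rewrite !incidence_eq0 ?mul0r.
have /(congr1 phi) := peirce f x y.
rewrite !alg_autM !phie peirce alg_autZ => /(congr1 (fun h : FI => h x y)).
by rewrite !finitaryZE munit_id // mulr1 mulrC.
Qed.

Lemma fixes_points_inner (phi : alg_aut K X) :
  mult_auts_inner K X -> fixes_points phi -> is_inner phi.
Proof.
move=> mult_inner /fixes_points_conj[u phiu].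
have [cu cuE] := conj_aut (alg_unit_rev u).
have [chi chiE] := alg_aut_comp cu phi.
have [x|s s_mult chis] := @fix_munits_mult chi.
  by rewrite chiE /= phiu cuE conj_byK.
have [w wE] := mult_inner s s_mult.
have uwV : alg_unit_val u * alg_unit_val w *
           (alg_unit_inv w * alg_unit_inv u) = 1.
  by rewrite mulrA -[_ * alg_unit_inv w]mulrA alg_unitVr mulr1 alg_unitVr.
have uwVl : alg_unit_inv w * alg_unit_inv u *
           (alg_unit_val u * alg_unit_val w) = 1.
  by rewrite mulrA -[_ * alg_unit_val u]mulrA alg_unitVl mulr1 alg_unitVl.
exists (AlgUnit uwV uwVl) => f.
rewrite -[LHS](conj_by_revK u) -cuE -[cu _]chiE chis wE /conj_by /=.
by rewrite !mulrA.
Qed.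

Lemma inner_inverse (phi phi' : alg_aut K X) :
  cancel phi phi' -> is_inner phi -> is_inner phi'.
Proof.
move=> phiK [u phiE]; exists (alg_unit_rev u) => f.
by rewrite -{1}[f](conj_by_revK u) -phiE phiK.
Qed.

(** * Transport along an automorphism of the poset *)

Section Pullback.
Variable alpha : poset_aut X.

Lemma pullback_incidence_subproof f :
  (fun x y => f (alpha x) (alpha y)) \in @incidence_pred K d X.
Proof.
by apply/asboolP => x y nxy; apply: incidence_eq0; rewrite -poset_aut_le.
Qed.

Lemma pullback_subproof f :
  Incidence (pullback_incidence_subproof f) \in @finitary_pred K d X.
Proof.
have [beta alphaK betaK] := poset_aut_bij alpha.
apply/asboolP => x y; rewrite (poset_aut_le alpha) => xy.
apply: (@sub_finite_set _ _ ((fun p => (beta p.1, beta p.2)) @` _)); last first.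
  exact: finite_image (finitary_fin f xy).
move=> [u v] /= [[xu uv vy] [nuv fuv]].
exists (alpha u, alpha v); last by rewrite /= !alphaK.
by rewrite /= -!poset_aut_le (can_eq alphaK).
Qed.

(** The automorphism of the algebra that alpha^-1 induces. *)
Definition pullback f : FI := Finitary (pullback_subproof f).

Lemma pullbackE f x y : pullback f x y = f (alpha x) (alpha y).
Proof. by []. Qed.

End Pullback.

Lemma poset_aut_inverse (alpha : poset_aut X) :
  exists beta : poset_aut X, cancel alpha beta /\ cancel beta alpha.
Proof.
have [beta alphaK betaK] := poset_aut_bij alpha.
have beta_le x y : (x <= y)%O = (beta x <= beta y)%O.
  by rewrite [RHS](poset_aut_le alpha) !betaK.
by exists (PosetAut beta_le (Bijective betaK alphaK)).
Qed.

Lemma pullback_aut (alpha : poset_aut X) :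
  exists chi : alg_aut K X, chi =1 pullback alpha.
Proof.
have [beta [alphaK betaK]] := poset_aut_inverse alpha.
have lin : linear (pullback alpha) by move=> c f g; apply: finitary_ext.
have morph : monoid_morphism (pullback alpha).
  split=> [|f g]; apply: finitary_ext => x y.
    by rewrite pullbackE !diagE (can_eq alphaK).
  rewrite pullbackE.
  have [r [ur inr]] := finite_uniq_seq (finitary_finr f (alpha x) (alpha y)).
  rewrite (@finitary_mulE _ _ _ _ _ _ _ r) //; last by move=> z *; apply: inr.
  rewrite (@finitary_mulE _ _ _ _ _ _ _ (map beta r)).
  - rewrite big_map; apply: eq_bigr => z _.
    by rewrite !pullbackE betaK.
  - by rewrite map_inj_uniq //; exact: can_inj betaK.
  - move=> z zy; rewrite pullbackE => fz; rewrite -[z]alphaK.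
    by apply/map_f/inr; split=> //; rewrite -poset_aut_le.
have bij : bijective (pullback alpha).
  by exists (pullback beta) => f; apply: finitary_ext => x y;
    rewrite !pullbackE ?alphaK ?betaK.
by exists (AlgAut lin morph bij).
Qed.

(** * Involutions *)

Section RhoEps.
Variable lam : poset_involution X.

Lemma rho_epsE (eps : fixpts lam -> nonzero K) f x y :
  rho_eps eps f x y =
  eps_ext eps x * f (lam y) (lam x) * (eps_ext eps y)^-1.
Proof. exact: rho_eps_funE. Qed.

Lemma rho_eps_diag (eps : fixpts lam -> nonzero K) f x :
  rho_eps eps f x x = f (lam x) (lam x).
Proof. by rewrite rho_epsE mulrAC mulfV ?mul1r // eps_ext_neq0. Qed.

Lemma rho_eps_munit (eps : fixpts lam -> nonzero K) x :
  rho_eps eps (munit x x) = munit (lam x) (lam x).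
Proof.
apply: finitary_ext => u v; rewrite rho_epsE !munitE !lexx /=.
rewrite ![lam _ == x](can2_eq (poset_invK lam) (poset_invK lam)).
case: eqVneq => [->|_]; last by rewrite andbF mulr0 mul0r.
by case: eqVneq => [->|_]; rewrite ?mulr0 ?mul0r // mulr1 mulfV ?eps_ext_neq0.
Qed.

Lemma pullback_rho_eps (alpha : poset_aut X)
    (comm : alpha \o lam =1 lam \o alpha) (eps : fixpts lam -> nonzero K) f :
  pullback alpha (rho_eps eps f) =
  rho_eps (eps \o fixpts_aut comm) (pullback alpha f).
Proof.
have extE x : eps_ext (eps \o fixpts_aut comm) x = eps_ext eps (alpha x).
  have commx := comm x; rewrite /= in commx.
  have [fx|nfx] := boolP (lam x == x).
    have fax : lam (alpha x) == alpha x by rewrite -commx (eqP fx).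
    rewrite /eps_ext !insubT /=; congr (val (eps _)).
    exact: val_inj.
  have nfax : lam (alpha x) != alpha x.
    by rewrite -commx (inj_eq (bij_inj (poset_aut_bij alpha))).
  by rewrite /eps_ext !insubN.
apply: finitary_ext => x y; rewrite pullbackE !rho_epsE pullbackE !extE.
by have := comm x; have := comm y; move=> /= -> ->.
Qed.

End RhoEps.

End Algebra.

(** * Equivalence of involutions *)

Theorem theorem6p26 (K : fieldType) (d : Order.disp_t) (X : porderType d)
    (charK : 2%N \notin [pchar K])
    (connX : connected_poset X)
    (mult_inner : mult_auts_inner K X)
    (der_inner : derivations_inner K X)
    (lam : poset_involution X)
    (lam_fix : exists x y : X, x <> y /\ lam x = x /\ lam y = y)
    (eps1 eps2 : fixpts lam -> nonzero K)
    (not_inner_equiv : ~ inner_equiv (rho_eps eps1) (rho_eps eps2)) :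
  alg_equiv (rho_eps eps1) (rho_eps eps2) <->
  exists (alpha : poset_aut X) (comm : alpha \o lam =1 lam \o alpha),
    inner_equiv (rho_eps (eps2 \o fixpts_aut comm)) (rho_eps eps1).
Proof.
split=> [[psi psi_rho]|[alpha [comm [phi [_ phi_rho]]]]]; last first.
  have [chi chiE] := pullback_aut K alpha.
  have [chi' [chiK chi'K]] := alg_aut_inverse chi.
  have [phi' [phiK phi'K]] := alg_aut_inverse phi.
  have [psi psiE] := alg_aut_comp chi' phi'.
  exists psi => f; rewrite /= !psiE /=; apply: (@alg_aut_inj _ _ _ chi).
  rewrite chi'K [RHS]chiE pullback_rho_eps -chiE chi'K.
  by apply: (@alg_aut_inj _ _ _ phi); rewrite phi'K [RHS]phi_rho /= phi'K.
have [alpha alphaP] := alg_aut_poset_aut psi.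
have comm : alpha \o lam =1 lam \o alpha.
  move=> x; rewrite /= -[LHS](poset_invK lam); congr (lam _).
  apply: rank1_diag_uniq (alg_aut_rank1 psi (munit_rank1 _ x)) _ (alphaP x).
  rewrite -(rho_eps_diag eps2) -[rho_eps eps2 _]psi_rho /=.
  by rewrite -[rho_eps_fun _ _]/(rho_eps eps1 _) rho_eps_munit alphaP.
exists alpha, comm.
have [chi chiE] := pullback_aut K alpha.
have [phi phiE] := alg_aut_comp chi psi.
have phi_inner : is_inner phi.
  apply: fixes_points_inner => // x.
  by rewrite phiE /= chiE pullbackE alphaP.
have [phi' [phiK phi'K]] := alg_aut_inverse phi.
exists phi'; split; first exact: inner_inverse phi_inner.
move=> f; apply: (@alg_aut_inj _ _ _ phi); rewrite /= phi'K phiE /=.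
have /= -> := psi_rho (phi' f); rewrite chiE.
rewrite -[rho_eps_fun eps2 _]/(rho_eps eps2 _) pullback_rho_eps -chiE.
by rewrite -[chi _]phiE phi'K.
Qed.
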